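(* Let $F^2$ be a smooth two-dimensional surface in the three-dimensional Euclidean space $E^3$. If $F^2$ is minimal and has harmonic second fundamental form $b$, i.e. $\Delta b \equiv 0$ on $F^2$, then $F^2$ is a plane $E^2 \subset E^3$ or its part.
   Context: A smooth surface $F^2$ in $E^3$ is given locally by a smooth vector equation $\vec r = \vec r(u^1,u^2) = \{x^1(u^1,u^2), x^2(u^1,u^2), x^3(u^1,u^2)\}$, where $(x^1,x^2,x^3)$ are Cartesian coordinates in $E^3$, $(u^1,u^2)$ are local coordinates on $F^2$, and the matrix $\left\|\partial x^a/\partial u^i\right\|$ has rank $2$ at every point. Let $g$ be the Riemannian metric induced on $F^2$ from $E^3$, with components $g_{ij}$ and inverse $(g^{ij})$, and let $\nabla$ be the Riemannian connection on $F^2$ determined by $g$. Let $\vec n$ be a local field of unit normal vectors and let $b = b_{ij}\,du^i du^j$, with $b_{ij} = \langle \partial^2_{ij}\vec r, \vec n\rangle$, be the second fundamental form, where $\langle\cdot,\cdot\rangle$ is the scalar product in $E^3$. The surface is minimal if its mean curvature $H=\tfrac12 g^{ij}b_{ij}$ vanishes identically. The Laplace operator applied to $b$ is $(\Delta b)_{ij} = g^{kl}\overline\nabla_k\overline\nabla_l b_{ij}$, where $\overline\nabla$ is the van der Waerden–Bortolotti covariant derivative (the connection induced by $\nabla$ and the normal connection). For a surface in $E^3$ this equals $(\Delta b)_{ij} = g^{kl}\nabla_k\nabla_l b_{ij}$. The second fundamental form $b$ is called harmonic if $\Delta b \equiv 0$ on $F^2$.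
   Formalization: The surface F^2 is assumed connected, which the statement leaves implicit; without this, the union of pieces of two parallel planes is minimal with harmonic second fundamental form but is not part of a single plane. *)

(* Defs.v *)
From HB Require Import structures.
From mathcomp Require Import all_boot all_order all_algebra.
From mathcomp Require Import all_classical all_reals all_analysis.

Set Implicit Arguments.
Unset Strict Implicit.
Unset Printing Implicit Defensive.

Import Order.TTheory GRing.Theory Num.Theory.
Import numFieldNormedType.Exports.

Local Open Scope classical_set_scope.
Local Open Scope ring_scope.

Definition scal (R : realType) (x y : 'rV[R]_3) : R :=
  \sum_(a < 3) x 0 a * y 0 a.

Definition is_plane (R : realType) (P : set 'rV[R]_3) : Prop :=
  exists (v : 'rV[R]_3) (c : R), v != 0 /\ P = [set x | scal v x = c].

Definition pd (R : realType) (V : normedModType R) (i : 'I_2)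
    (f : 'rV[R]_2 -> V) (u : 'rV[R]_2) : V :=
  'D_(delta_mx 0 i) f u.

Definition iter_pd (R : realType) (V : normedModType R) (s : seq 'I_2)
    (f : 'rV[R]_2 -> V) : 'rV[R]_2 -> V :=
  foldr (fun i h => pd i h) f s.

Definition smooth_on (R : realType) (V : normedModType R)
    (U : set 'rV[R]_2) (f : 'rV[R]_2 -> V) : Prop :=
  forall (s : seq 'I_2) (u : 'rV[R]_2), U u ->
    {for u, continuous (iter_pd s f)} /\
    forall i : 'I_2, derivable (iter_pd s f) u (delta_mx 0 i).

Section LocalGeometry.
Variables (R : realType) (r n : 'rV[R]_2 -> 'rV[R]_3).
Implicit Types (i j k l m : 'I_2) (u : 'rV[R]_2).

Definition coord_jacobian u : 'M[R]_(3, 2) :=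
  \matrix_(a < 3, i < 2) pd i r u 0 a.

Definition metric u : 'M[R]_2 := \matrix_(i, j) scal (pd i r u) (pd j r u).

Definition metric_inv u : 'M[R]_2 := invmx (metric u).

(* christoffel k i j is \Gamma^k_{ij}, with k the upper index. *)
Definition christoffel k i j u : R :=
  2^-1 * \sum_(l < 2) metric_inv u k l *
    (pd i (fun v => metric v j l) u + pd j (fun v => metric v i l) u
     - pd l (fun v => metric v i j) u).

(* For covariant tensors, the index of differentiation comes first:
   cov2 T l i j is \nabla_l T_{ij} and cov3 T k l i j is \nabla_k T_{lij}. *)
Definition cov2 (T : 'I_2 -> 'I_2 -> 'rV[R]_2 -> R) l i j u : R :=
  pd l (T i j) u
  - \sum_(m < 2) christoffel m l i u * T m j u
  - \sum_(m < 2) christoffel m l j u * T i m u.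

Definition cov3 (T : 'I_2 -> 'I_2 -> 'I_2 -> 'rV[R]_2 -> R) k l i j u : R :=
  pd k (T l i j) u
  - \sum_(m < 2) christoffel m k l u * T m i j u
  - \sum_(m < 2) christoffel m k i u * T l m j u
  - \sum_(m < 2) christoffel m k j u * T l i m u.

Definition second_form i j u : R := scal (pd i (pd j r) u) (n u).

Definition mean_curvature u : R :=
  2^-1 * \sum_(i < 2) \sum_(j < 2) metric_inv u i j * second_form i j u.

(* The normal connection of a surface in the 3-space is flat and n is parallel
   for it, so the van der Waerden-Bortolotti derivative of the scalar
   components second_form i j is their Levi-Civita covariant derivative. *)
Definition laplacian_second_form i j u : R :=
  \sum_(k < 2) \sum_(l < 2)
    metric_inv u k l * cov3 (cov2 second_form) k l i j u.

(* Such a field equals, up to a locally constant sign, the normalized cross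
   product of the partial derivatives of r; hence continuity is enough for it
   to be smooth. *)
Definition unit_normal_field (U : set 'rV[R]_2) : Prop :=
  {within U, continuous n} /\
  forall u, U u ->
    scal (n u) (n u) = 1 /\ forall i, scal (n u) (pd i r u) = 0.

End LocalGeometry.

(* Surfaces are immersed: M is the abstract surface and f its position vector.
   An embedded surface is the case where M is a subspace of the 3-space and f
   the inclusion.  A local parametrization is a homeomorphism phi from an open
   U onto an open subset of M such that r = f \o phi is a smooth map of rank 2;
   phi is not constrained outside U.  Changes of parametrization are then
   automatically smooth, so that M needs no separate differentiable
   structure. *)
Definition local_param (R : realType) (M : topologicalType)
    (f : M -> 'rV[R]_3) (U : set 'rV[R]_2) (phi : 'rV[R]_2 -> M) : Prop :=
  [/\ open U,
      {within U, continuous phi},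
      {in U &, injective phi},
      forall V : set 'rV[R]_2, V `<=` U -> open V -> open (phi @` V) &
      smooth_on U (f \o phi) /\
      forall u, U u -> \rank (coord_jacobian (f \o phi) u) = 2%N].

Definition is_surface (R : realType) (M : topologicalType)
    (f : M -> 'rV[R]_3) : Prop :=
  [/\ hausdorff_space M, @second_countable M &
      forall p : M, exists (U : set 'rV[R]_2) (phi : 'rV[R]_2 -> M),
        local_param f U phi /\ (phi @` U) p].

(* Changing the local parametrization or the sign of the normal field
   preserves the vanishing conditions below; they are required for all
   choices. *)
Definition is_minimal (R : realType) (M : topologicalType)
    (f : M -> 'rV[R]_3) : Prop :=
  forall (U : set 'rV[R]_2) (phi : 'rV[R]_2 -> M) (n : 'rV[R]_2 -> 'rV[R]_3),
    local_param f U phi -> unit_normal_field (f \o phi) n U ->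
    forall u, U u -> mean_curvature (f \o phi) n u = 0.

Definition has_harmonic_second_form (R : realType) (M : topologicalType)
    (f : M -> 'rV[R]_3) : Prop :=
  forall (U : set 'rV[R]_2) (phi : 'rV[R]_2 -> M) (n : 'rV[R]_2 -> 'rV[R]_3),
    local_param f U phi -> unit_normal_field (f \o phi) n U ->
    forall u, U u ->
    forall i j : 'I_2, laplacian_second_form (f \o phi) n i j u = 0.

(* Main.v *)
(* In an arbitrary chart, the Codazzi equation, the Ricci identity and the Gauss
   equation give Simons' identity: for a minimal surface the trace of
   nabla nabla b equals - |b|^2 b. A harmonic b therefore satisfies
   |b|^2 b = 0. With A the shape operator, |b|^2 = tr(A^2); as tr A = 0, its
   vanishing forces det A = 0, so b = 0. Hence the unit normal is constant on
   each small coordinate ball, whose image lies in a plane. Such a plane is the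
   tangent plane at each of its points, so that planes agree on overlaps and
   connectedness concludes. *)

From HB Require Import structures.
Require Import Defs.
From mathcomp Require Import all_boot all_order all_algebra.
From mathcomp Require Import all_classical all_reals all_analysis.
From mathcomp Require Import ring lra.

Set Implicit Arguments.
Unset Strict Implicit.
Unset Printing Implicit Defensive.

Import Order.TTheory GRing.Theory Num.Theory.
Import numFieldNormedType.Exports.
Local Open Scope classical_set_scope.
Local Open Scope ring_scope.

(** * Calculus of partial derivatives *)

(** No special coordinates are chosen: with only two values per index, sums are expanded and each
    tensor identity becomes a polynomial identity for [ring], modulo the structure equations. The
    price is that the matrix of [A] need not be symmetric, so [b = 0] has to be drawn from
    [tr A = det A = 0] by the positivity of the metric. Minimality enters on a whole open set, since
    its equation is differentiated twice, whereas harmonicity is used point by point. Both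
    hypotheses range over all unit normal fields; the normalized cross product is the one chosen,
    because its smoothness, and with it that of [b], can be computed. Smoothness is given in terms
    of iterated partial derivatives only, so the symmetry of second derivatives and constancy on
    balls come from the mean value theorem along coordinate directions. *)

Section Lines.
Context {R : realType} {V : normedModType R}.
Implicit Types (f : V -> R) (v w : V) (a b s : R).

Lemma is_derive_line f v w s : derivable f (s *: v + w) v ->
  is_derive s (1 : R) (fun t : R => f (t *: v + w)) ('D_v f (s *: v + w)).
Proof.
have E : (fun h : R => h^-1 *: (((fun t : R => f (t *: v + w)) \o shift s) h%:A
    - f (s *: v + w))) =
  (fun h : R => h^-1 *: ((f \o shift (s *: v + w)) (h *: v) - f (s *: v + w))).
  by apply/funext => h /=; rewrite /shift/= [h%:A]mulr1 scalerDl addrA.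
by move=> df; split; rewrite /derivable /derive E.
Qed.

Lemma MVT_line f v w a b : a <= b ->
  (forall s, a <= s <= b -> derivable f (s *: v + w) v) ->
  exists2 s, a <= s <= b &
    f (b *: v + w) - f (a *: v + w) = 'D_v f (s *: v + w) * (b - a).
Proof.
move=> ab df.
have [s|s|s] := @MVT_segment R (fun t => f (t *: v + w))
  (fun t => 'D_v f (t *: v + w)) a b ab.
- rewrite in_itv/= => /andP[/ltW as_ /ltW sb].
  by apply: is_derive_line; apply: df; rewrite as_.
- apply: derivable_within_continuous => {}s; rewrite in_itv/= => sab.
  by have [] := is_derive_line (df _ sab).
- by rewrite in_itv/= => sab E; exists s.
Qed.

Lemma line_cst f v w a :
  (forall s, `|s| <= `|a| -> derivable f (s *: v + w) v /\ 'D_v f (s *: v + w) = 0) ->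
  f (a *: v + w) = f w.
Proof.
move=> H; have [a0|a0] := leP 0 a.
  have [s|s sa] := @MVT_line f v w 0 a a0.
    case/andP=> s0 sa; apply: (H s _).1.
    by rewrite !ger0_norm.
  case/andP: sa => s0 sa.
  rewrite (H s _).2 ?mul0r ?scale0r ?add0r; last by rewrite !ger0_norm.
  by move/eqP; rewrite subr_eq0 => /eqP.
have [s|s sa] := @MVT_line f v w a 0 (ltW a0).
  case/andP=> sa s0; apply: (H s _).1.
  by rewrite !ler0_norm ?lerN2// ltW.
case/andP: sa => sa s0.
rewrite (H s _).2 ?mul0r ?scale0r ?add0r; last by rewrite !ler0_norm ?lerN2// ltW.
by move/eqP; rewrite subr_eq0 => /eqP.
Qed.

End Lines.

(* Locked, as unification would otherwise unfold derivatives to limits. *)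
HB.lock Definition partial (R : realType) (V : normedModType R) (i : 'I_2)
  (f : 'rV[R]_2 -> V) : 'rV[R]_2 -> V := pd i f.

Lemma pd_partial : @pd = @partial.
Proof. by rewrite partial.unlock. Qed.

Lemma partialE (R : realType) (V : normedModType R) (i : 'I_2)
  (f : 'rV[R]_2 -> V) u : partial i f u = 'D_('e_i) f u.
Proof. by rewrite partial.unlock. Qed.

(** * Closure properties of smooth functions on an open set *)

Section Smooth.
Context {R : realType} (U : set 'rV[R]_2) (oU : open U).
Implicit Types (f g : 'rV[R]_2 -> R) (u : 'rV[R]_2) (i j : 'I_2).

(** The recursion on the order is what the closure lemmas induct on; with the words of derivatives
    of [smooth_on], a product would call for a full Leibniz expansion. Continuity is asked at each
    order, since partial derivatives can exist without it. *)
Fixpoint Ck (k : nat) f : Prop :=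
  (forall u, U u -> {for u, continuous f}) /\
  if k is k'.+1 then forall i,
    (forall u, U u -> derivable f u ('e_i)) /\ Ck k' (partial i f)
  else True.

Definition smooth f := forall k, Ck k f.

Lemma nbhs_U u : U u -> \forall v \near u, U v.
Proof. by move=> Uu; apply: open_nbhs_nbhs. Qed.

Lemma partial_ext (V : normedModType R) (f g : 'rV[R]_2 -> V) i u :
  {in U, f =1 g} -> U u -> partial i f u = partial i g u.
Proof.
move=> fg Uu; rewrite !partialE; apply: near_eq_derive; apply: filterS (nbhs_U Uu) => v Uv.
by apply: fg; rewrite inE.
Qed.

Lemma continuous_ext f g u : {in U, f =1 g} -> U u ->
  {for u, continuous f} -> {for u, continuous g}.
Proof.
move=> fg Uu cf; have E : f u = g u by apply: fg; rewrite inE.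
have nfg : {near u, f =1 g}.
  by apply: filterS (nbhs_U Uu) => v Uv; apply: fg; rewrite inE.
rewrite /prop_for /continuous_at -E.
exact: cvg_trans (near_eq_cvg nfg) cf.
Qed.

Lemma Ck_ext k f g : {in U, f =1 g} -> Ck k f -> Ck k g.
Proof.
elim: k f g => [|k IH] f g fg /=.
  by move=> [cf _]; split=> // u Uu; exact: continuous_ext fg _ (cf _ Uu).
move=> [cf df]; split=> [u Uu|i]; first exact: continuous_ext fg _ (cf _ Uu).
split=> [u Uu|].
  apply: near_eq_derivable ((df i).1 u Uu).
  by apply: filterS (nbhs_U Uu) => v Uv; apply: fg; rewrite inE.
apply: IH (df i).2 => u; rewrite inE => Uu; exact: partial_ext.
Qed.

Lemma CkW k f : Ck k.+1 f -> Ck k f.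
Proof.
elim: k f => [|k IH] f /=; first by case.
by move=> [cf df]; split=> // i; split; [exact: (df i).1|exact: IH (df i).2].
Qed.

Lemma Ck0 k f : Ck k f -> forall u, U u -> {for u, continuous f}.
Proof. by case: k => [|k] []. Qed.

Lemma Ck_is_derive k f i u : Ck k.+1 f -> U u ->
  is_derive u ('e_i) f (partial i f u).
Proof.
by move=> [_ /(_ i)[df _]] Uu; rewrite partialE; exact/derivableP/df.
Qed.

(** A formula [df] valid on [U] is enough to climb one order: outside [U] it may differ from
    [partial i f], which [Ck_ext] tolerates. *)
Lemma Ck_step k f (df : 'I_2 -> 'rV[R]_2 -> R) :
  (forall u, U u -> {for u, continuous f}) ->
  (forall i u, U u -> is_derive u ('e_i) f (df i u)) ->
  (forall i, Ck k (df i)) -> Ck k.+1 f.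
Proof.
move=> cf H C; split=> // i; split=> [u /(H i)[]//|].
apply: Ck_ext (C i) => u; rewrite inE => Uu.
by rewrite partialE; have [_ /esym] := H i u Uu.
Qed.

Lemma Ck_cst k (c : R) : Ck k (fun=> c).
Proof.
elim: k c => [|k IH] c.
  by split=> // u _; exact: cst_continuous.
by apply: (@Ck_step k _ (fun _ _ => 0)) => // u _; exact: cst_continuous.
Qed.

Lemma CkD k f g : Ck k f -> Ck k g -> Ck k (fun u => f u + g u).
Proof.
elim: k f g => [|k IH] f g Cf Cg.
  by split=> // u Uu; apply: continuousD; [exact: Ck0 Cf u Uu|exact: Ck0 Cg u Uu].
apply: (@Ck_step k _ (fun i u => partial i f u + partial i g u)).
- by move=> u Uu; apply: continuousD; [exact: Ck0 Cf u Uu|exact: Ck0 Cg u Uu].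
- move=> i u Uu; apply: is_deriveD; [exact: (Ck_is_derive i Cf)|exact: (Ck_is_derive i Cg)].
- by move=> i; apply: IH; [exact: (Cf.2 i).2|exact: (Cg.2 i).2].
Qed.

Lemma CkM k f g : Ck k f -> Ck k g -> Ck k (fun u => f u * g u).
Proof.
elim: k f g => [|k IH] f g Cf Cg.
  by split=> // u Uu; apply: continuousM; [exact: Ck0 Cf u Uu|exact: Ck0 Cg u Uu].
apply: (@Ck_step k _ (fun i u => f u * partial i g u + g u * partial i f u)).
- by move=> u Uu; apply: continuousM; [exact: Ck0 Cf u Uu|exact: Ck0 Cg u Uu].
- move=> i u Uu; apply: is_deriveM; [exact: (Ck_is_derive i Cf)|exact: (Ck_is_derive i Cg)].
- move=> i; have Cf' := CkW Cf; have Cg' := CkW Cg.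
  by apply: CkD; apply: IH => //; [exact: (Cg.2 i).2|exact: (Cf.2 i).2].
Qed.

(** The derivative of [1/f] is a polynomial in [1/f] and the derivative of [f], so the induction
    hypothesis for [1/f] itself closes the step. The same holds for [1/sqrt f] below. *)
Lemma Ck_inv k f : (forall u, U u -> f u != 0) -> Ck k f ->
  Ck k (fun u => (f u)^-1).
Proof.
move=> f0; elim: k => [|k IH] Cf.
  by split=> // u Uu; apply: continuousV; [exact: f0|exact: Ck0 Cf u Uu].
apply: (@Ck_step k _ (fun i u => -1 * ((f u)^-1 * (f u)^-1) * partial i f u)).
- by move=> u Uu; apply: continuousV; [exact: f0|exact: Ck0 Cf u Uu].
- move=> i u Uu; have df := (Cf.2 i).1 u Uu;
  split; first exact: derivableV (f0 u Uu) df.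
  by rewrite deriveV ?f0// -exprVn expr2 mulN1r partialE.
- move=> i; apply: CkM; last exact: (Cf.2 i).2.
  by apply: CkM; [exact: Ck_cst|apply: CkM; apply: IH; exact: CkW].
Qed.

(** The one-variable chain rule is applied to the restriction of [f] to the line through [u] in
    direction [v], at parameter 0; the difference quotients are then identified. *)
Lemma is_derive_rsqrt f u v : 0 < f u -> derivable f u v ->
  is_derive u v (fun x => (Num.sqrt (f x))^-1)
    (- 2^-1 * (Num.sqrt (f u))^-1 ^+ 3 * 'D_v f u).
Proof.
move=> fu df.
have E0 : (0 : R) *: v + u = u by rewrite scale0r add0r.
have df' : derivable f ((0 : R) *: v + u) v by rewrite E0.
have D := is_derive_line df'.
have S0 : Num.sqrt (f u) != 0 by rewrite gt_eqF// sqrtr_gt0.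
have D2 : is_derive (0 : R) (1 : R) (fun t : R => Num.sqrt (f (t *: v + u)))
    ((2 * Num.sqrt (f (0 *: v + u)))^-1 * 'D_v f (0 *: v + u)).
  have P : 0 < f ((0 : R) *: v + u) by rewrite E0.
  exact: is_derive1_comp (is_derive1_sqrt P) D.
have D3 : is_derive (0 : R) (1 : R) (fun t : R => (Num.sqrt (f (t *: v + u)))^-1)
    (- (Num.sqrt (f (0 *: v + u))) ^- 2 *:
      ((2 * Num.sqrt (f (0 *: v + u)))^-1 * 'D_v f (0 *: v + u))).
  by apply: is_deriveV; rewrite E0.
rewrite !E0 in D3; case: D3 => D31 D32; split.
  exact: (derivable1P (fun x => (Num.sqrt (f x))^-1) u v).2 D31.
have <- : - Num.sqrt (f u) ^- 2 *: ((2 * Num.sqrt (f u))^-1 * 'D_v f u) =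
  - 2^-1 * (Num.sqrt (f u))^-1 ^+ 3 * 'D_v f u.
  rewrite /GRing.scale/=; field.
  exact: S0.
rewrite -D32 /derive.
suff -> : (fun h : R => h^-1 *:
    (((fun t : R => (Num.sqrt (f (t *: v + u)))^-1) \o shift 0) h%:A
    - (Num.sqrt (f (0 *: v + u)))^-1)) =
  (fun h : R => h^-1 *: (((fun x => (Num.sqrt (f x))^-1) \o shift u) (h *: v)
    - (Num.sqrt (f u))^-1)) by [].
by apply/funext => h /=; rewrite /shift/= E0 addr0 [h%:A]mulr1.
Qed.

Lemma Ck_rsqrt k f : (forall u, U u -> 0 < f u) -> Ck k f ->
  Ck k (fun u => (Num.sqrt (f u))^-1).
Proof.
move=> f0 Cf.
have c u : U u -> {for u, continuous (fun u => (Num.sqrt (f u))^-1)}.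
  move=> Uu; apply: continuousV; first by rewrite gt_eqF// sqrtr_gt0 f0.
  apply: (@continuous_comp _ _ _ f Num.sqrt); first exact: (Ck0 Cf).
  exact: sqrt_continuous.
elim: k Cf => [|k IH] Cf; first by split.
apply: (@Ck_step k _ (fun i u => - 2^-1 * ((Num.sqrt (f u))^-1 * ((Num.sqrt (f u))^-1 *
   (Num.sqrt (f u))^-1)) * partial i f u)) => //.
- move=> i u Uu; have df := (Cf.2 i).1 u Uu.
  by rewrite partialE; exact: is_derive_rsqrt (f0 u Uu) df.
- move=> i; apply: CkM; last exact: (Cf.2 i).2.
  have {}IH := IH (CkW Cf).
  by apply: CkM; [exact: Ck_cst|do 2![apply: CkM => //]].
Qed.

Lemma smooth_cst (c : R) : smooth (fun=> c).
Proof. by move=> k; exact: Ck_cst. Qed.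

Lemma smooth_ext f g : {in U, f =1 g} -> smooth f -> smooth g.
Proof. by move=> fg Sf k; exact: Ck_ext fg (Sf k). Qed.

Lemma smoothD f g : smooth f -> smooth g -> smooth (fun u => f u + g u).
Proof. by move=> Sf Sg k; exact: CkD. Qed.

Lemma smoothM f g : smooth f -> smooth g -> smooth (fun u => f u * g u).
Proof. by move=> Sf Sg k; exact: CkM. Qed.

Lemma smoothN f : smooth f -> smooth (fun u => - f u).
Proof.
move=> Sf; apply: (@smooth_ext (fun u => -1 * f u)).
  by move=> u _; rewrite mulN1r.
by apply: smoothM => //; exact: smooth_cst.
Qed.

Lemma smoothB f g : smooth f -> smooth g -> smooth (fun u => f u - g u).
Proof. by move=> Sf Sg; apply: smoothD => //; exact: smoothN. Qed.

Lemma smooth_sum n (f : 'I_n -> 'rV[R]_2 -> R) :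
  (forall k, smooth (f k)) -> smooth (fun u => \sum_(k < n) f k u).
Proof.
elim: n f => [|n IH] f Sf.
  by apply: smooth_ext (smooth_cst 0) => u _; rewrite big_ord0.
apply: (@smooth_ext (fun u => f ord0 u + \sum_(k < n) f (lift ord0 k) u)).
  by move=> u _; rewrite big_ord_recl.
by apply: smoothD => //; exact: IH.
Qed.

Lemma smoothV f : (forall u, U u -> f u != 0) -> smooth f ->
  smooth (fun u => (f u)^-1).
Proof. by move=> f0 Sf k; exact: Ck_inv. Qed.

Lemma smooth_rsqrt f : (forall u, U u -> 0 < f u) -> smooth f ->
  smooth (fun u => (Num.sqrt (f u))^-1).
Proof. by move=> f0 Sf k; exact: Ck_rsqrt. Qed.

Lemma smooth_partial i f : smooth f -> smooth (partial i f).
Proof. by move=> Sf k; exact: ((Sf k.+1).2 i).2. Qed.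

Lemma smooth_continuous f u : smooth f -> U u -> {for u, continuous f}.
Proof. by move=> Sf; exact: (Sf 0%N).1. Qed.

Lemma smooth_derivable i f u : smooth f -> U u -> derivable f u ('e_i).
Proof. by move=> Sf; exact: ((Sf 1%N).2 i).1. Qed.

Lemma smooth_is_derive i f u : smooth f -> U u ->
  is_derive u ('e_i) f (partial i f u).
Proof. by move=> Sf Uu; exact: (Ck_is_derive i (Sf 1%N) Uu). Qed.

Lemma partial_cst (c : R) i u : partial i (fun=> c) u = 0.
Proof. by rewrite partialE; exact: derive_cst. Qed.

Lemma partialD i f g u : smooth f -> smooth g -> U u ->
  partial i (fun v => f v + g v) u = partial i f u + partial i g u.
Proof.
move=> Sf Sg Uu; have df := smooth_is_derive i Sf Uu.
have dg := smooth_is_derive i Sg Uu.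
by rewrite [LHS]partialE; have [_] := is_deriveD df dg; exact.
Qed.

Lemma partialM i f g u : smooth f -> smooth g -> U u ->
  partial i (fun v => f v * g v) u = partial i f u * g u + f u * partial i g u.
Proof.
move=> Sf Sg Uu; have df := smooth_is_derive i Sf Uu.
have dg := smooth_is_derive i Sg Uu.
have [_ E] := is_deriveM df dg.
by rewrite [LHS]partialE addrC [partial i f u * _]mulrC; exact: E.
Qed.

Lemma partialN i f u : smooth f -> U u -> partial i (fun v => - f v) u = - partial i f u.
Proof.
move=> Sf Uu; have df := smooth_is_derive i Sf Uu.
by rewrite [LHS]partialE; have [_] := is_deriveN df; exact.
Qed.

Lemma partialB i f g u : smooth f -> smooth g -> U u ->
  partial i (fun v => f v - g v) u = partial i f u - partial i g u.
Proof. by move=> Sf Sg Uu; rewrite partialD ?partialN//; exact: smoothN. Qed.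

Lemma partial_sum i n (f : 'I_n -> 'rV[R]_2 -> R) u : (forall k, smooth (f k)) ->
  U u -> partial i (fun v => \sum_(k < n) f k v) u = \sum_(k < n) partial i (f k) u.
Proof.
elim: n f => [|n IH] f Sf Uu.
  rewrite big_ord0; apply: etrans (partial_cst 0 i u); apply: partial_ext => // v _.
  by rewrite big_ord0.
rewrite big_ord_recl -IH// -partialD//; last exact: smooth_sum.
by apply: partial_ext => // v _; rewrite big_ord_recl.
Qed.

End Smooth.

(** * Symmetry of second partial derivatives *)

Section Schwarz.
Context {R : realType} (U : set 'rV[R]_2) (oU : open U).
Implicit Types (f g : 'rV[R]_2 -> R) (u : 'rV[R]_2) (i j : 'I_2).
Local Notation smooth := (smooth U).
(** The mean value theorem is used twice: along ['e_i] for the increment [g] of [f] in direction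
    ['e_j], then along ['e_j] for [partial i f]. *)
Lemma second_difference i j f u h : smooth f -> 0 < h ->
  (forall s t, 0 <= s <= h -> 0 <= t <= h -> U (s *: 'e_i + (t *: 'e_j + u))) ->
  exists s t, [/\ 0 <= s <= h, 0 <= t <= h &
    f (h *: 'e_i + (h *: 'e_j + u)) - f (h *: 'e_i + u)
      - f (h *: 'e_j + u) + f u =
    partial j (partial i f) (s *: 'e_i + (t *: 'e_j + u)) * h * h].
Proof.
move=> Sf h0 HU; have h0' := ltW h0.
pose g x := f (h *: 'e_j + x) - f x.
have HU0 s : 0 <= s <= h -> U (s *: 'e_i + u).
  by move=> sh; have := HU s 0 sh; rewrite scale0r add0r; apply; rewrite lexx.
have dshift x : U (h *: 'e_j + x) ->
    is_derive x ('e_i) (fun y => f (h *: 'e_j + y)) (partial i f (h *: 'e_j + x)).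
  have E : (fun y : R => y^-1 *: (((fun y => f (h *: 'e_j + y)) \o shift x) (y *: 'e_i)
      - f (h *: 'e_j + x))) =
    (fun y : R => y^-1 *: ((f \o shift (h *: 'e_j + x)) (y *: 'e_i) - f (h *: 'e_j + x))).
    by apply/funext => y /=; rewrite /shift/= addrCA.
  move=> Ux; have df := smooth_derivable (i:=i) Sf Ux.
  by split; rewrite ?partialE /derivable /derive E.
have dg s : 0 <= s <= h -> is_derive (s *: 'e_i + u) ('e_i) g
   (partial i f (h *: 'e_j + (s *: 'e_i + u)) - partial i f (s *: 'e_i + u)).
  move=> sh; apply: is_deriveB.
    by apply: dshift; rewrite addrCA; apply: HU => //; rewrite h0' lexx.
  by apply: smooth_is_derive => //; exact: HU0.
have [s sh E1] : exists2 s, 0 <= s <= h & g (h *: 'e_i + u) - g (0 *: 'e_i + u) =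
    'D_('e_i) g (s *: 'e_i + u) * (h - 0).
  by apply: MVT_line => // s sh; have [] := dg s sh.
have [t th E2] : exists2 t, 0 <= t <= h &
    partial i f (h *: 'e_j + (s *: 'e_i + u)) - partial i f (0 *: 'e_j + (s *: 'e_i + u)) =
    'D_('e_j) (partial i f) (t *: 'e_j + (s *: 'e_i + u)) * (h - 0).
  apply: MVT_line h0' _ => t th.
  apply: (smooth_derivable (U := U)); first exact: smooth_partial.
  by rewrite addrCA; exact: HU.
exists s, t; split => //.
have [_ E3] := dg s sh.
rewrite E3 subr0 in E1; rewrite scale0r add0r subr0 in E2.
rewrite (addrCA (s *: _)).
have -> : partial j (partial i f) (t *: 'e_j + (s *: 'e_i + u)) * h * h =
    g (h *: 'e_i + u) - g (0 *: 'e_i + u) by rewrite E1 E2 partialE.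
by rewrite scale0r add0r /g (addrCA (h *: 'e_j)); ring.
Qed.

(** The second difference is symmetric in [i] and [j], so the two mixed derivatives take a common
    value [z] at two points close to [u]; by continuity each of their values at [u] is within
    [e / 2] of [z]. *)
Lemma schwarz i j f u : smooth f -> U u ->
  partial i (partial j f) u = partial j (partial i f) u.
Proof.
move=> Sf Uu; apply/eqP; rewrite -subr_eq0 -normr_le0.
apply/ler_addgt0Pl => e e0; rewrite addr0.
have C a b : \forall x \near u, `|partial a (partial b f) u - partial a (partial b f) x| < e / 2.
  have /cvgrPdist_lt := smooth_continuous (smooth_partial a (smooth_partial b Sf)) Uu.
  by apply; rewrite divr_gt0.
have /nbhs_ballP[d /= d0 dP] : \forall x \near u, U x /\
    (`|partial i (partial j f) u - partial i (partial j f) x| < e / 2 /\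
    `|partial j (partial i f) u - partial j (partial i f) x| < e / 2).
  apply: filterI; first exact: nbhs_U.
  by apply: filterI; exact: C.
(* With side [d / 4] the square stays in the ball even if [a = b], when both displacements add up in
   one coordinate. *)
have h0 : 0 < d / 4 by rewrite divr_gt0.
have ball_ a b (s t : R) : 0 <= s <= d / 4 -> 0 <= t <= d / 4 ->
    ball u d (s *: 'e_a + (t *: 'e_b + u)).
  move=> /andP[s0 sd] /andP[t0 td]; split=> // k l.
  rewrite /ball/= !mxE.
  have n1 (c : bool) : `|c%:R : R| <= 1 by case: c; rewrite ?normr0 ?normr1.
  rewrite -normrN (_ : - _ = s * ((k == 0) && (l == a))%:R +
    t * ((k == 0) && (l == b))%:R); last by ring.
  apply: le_lt_trans (ler_normD _ _) _; rewrite !normrM !ger0_norm//.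
  have p1 (c : bool) (x : R) : 0 <= x -> x * c%:R <= x by case: c; rewrite ?mulr1 ?mulr0.
  apply: (@le_lt_trans _ _ (s + t)); first by apply: lerD; exact: p1.
  by lra.
have [s1 [t1 [Hs1 Ht1 E1]]] := second_difference Sf h0
  (fun s t hs ht => (dP _ (ball_ i j s t hs ht)).1).
have [s2 [t2 [Hs2 Ht2 E2]]] := second_difference Sf h0
  (fun s t hs ht => (dP _ (ball_ j i s t hs ht)).1).
have E : partial j (partial i f) (s1 *: 'e_i + (t1 *: 'e_j + u)) =
    partial i (partial j f) (s2 *: 'e_j + (t2 *: 'e_i + u)).
  have h0' : d / 4 != 0 by rewrite gt_eqF.
  apply: (mulIf h0'); apply: (mulIf h0').
  apply: etrans (esym E1) _; apply: etrans _ E2.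
  by rewrite (addrCA (d / 4 *: 'e_i)); ring.
have [_ [_ A]] := dP _ (ball_ i j s1 t1 Hs1 Ht1).
have [_ [B _]] := dP _ (ball_ j i s2 t2 Hs2 Ht2).
rewrite {}E in A.
set x := partial i (partial j f) u in B *; set y := partial j (partial i f) u in A *.
set z := partial i _ _ in A B; clearbody x y z.
have -> : x - y = (x - z) - (y - z) by ring.
apply: le_trans (ler_normB _ _) _; by rewrite (splitr e) lerD// ltW.
Qed.

End Schwarz.

(** * Vector fields along a chart, treated coordinate by coordinate *)

Section VectorFields.
Context {R : realType} (U : set 'rV[R]_2) (oU : open U).
Implicit Types (f : 'rV[R]_2 -> R) (u : 'rV[R]_2) (i j : 'I_2).
Implicit Types (x y : 'rV[R]_2 -> 'rV[R]_3).

Definition vsmooth x := forall a, smooth U (fun u => x u 0 a).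

Lemma vsmooth_derivable i x u : vsmooth x -> U u -> derivable x u 'e_i.
Proof.
move=> Sx Uu; apply/derivable_mxP => a b; rewrite (ord1 a).
exact: smooth_derivable (Sx b) Uu.
Qed.

Lemma partial_coord i x u a : vsmooth x -> U u ->
  partial i x u 0 a = partial i (fun v => x v 0 a) u.
Proof.
move=> Sx Uu; rewrite !partialE derive_mx; first by rewrite mxE.
exact: vsmooth_derivable.
Qed.

Lemma vsmooth_partial i x : vsmooth x -> vsmooth (partial i x).
Proof.
move=> Sx a; apply: (smooth_ext oU) (smooth_partial i (Sx a)) => u.
by rewrite inE => Uu; rewrite partial_coord.
Qed.

(** The derivative [pd i] is applied before those of [s], so it sits at the end of the word. *)
Lemma smooth_on_pd (V : normedModType R) i (F : 'rV[R]_2 -> V) :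
  smooth_on U F -> smooth_on U (pd i F).
Proof.
move=> SF s u Uu; have := SF (rcons s i) u Uu.
by rewrite /iter_pd -cats1 foldr_cat.
Qed.

Lemma smooth_on_vsmooth x : smooth_on U x -> vsmooth x.
Proof.
move=> Sx a k; elim: k x Sx => [|k IH] x Sx.
  split=> // u Uu; have [cx _] := Sx [::] u Uu.
  exact: (continuous_comp cx (@coord_continuous _ _ _ 0 a (x u))).
have D i u : U u -> derivable x u 'e_i by move=> Uu; have [_ /(_ i)] := Sx [::] u Uu.
apply: (Ck_step oU (df := fun i u => partial i x u 0 a)).
- move=> u Uu; have [cx _] := Sx [::] u Uu.
  exact: (continuous_comp cx (@coord_continuous _ _ _ 0 a (x u))).
- move=> i u Uu; rewrite partialE derive_mx ?mxE; last exact: D.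
  by have /derivable_mxP/(_ 0 a) := D i u Uu; exact: derivableP.
- by move=> i; apply: IH; rewrite partial.unlock; exact: smooth_on_pd.
Qed.

Lemma vsmoothZ f x : smooth U f -> vsmooth x -> vsmooth (fun u => f u *: x u).
Proof.
move=> Sf Sx a; apply: (smooth_ext oU) (smoothM oU Sf (Sx a)) => u _.
by rewrite mxE.
Qed.

Lemma vsmoothD x y : vsmooth x -> vsmooth y -> vsmooth (fun u => x u + y u).
Proof.
move=> Sx Sy a; apply: (smooth_ext oU) (smoothD oU (Sx a) (Sy a)) => u _.
by rewrite mxE.
Qed.

Lemma vsmooth_sum n (x : 'I_n -> 'rV[R]_2 -> 'rV[R]_3) :
  (forall k, vsmooth (x k)) -> vsmooth (fun u => \sum_k x k u).
Proof.
move=> Sx a; apply: (smooth_ext oU) (smooth_sum oU (fun k => Sx k a)) => u _.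
by rewrite summxE.
Qed.

Lemma smooth_scal x y : vsmooth x -> vsmooth y ->
  smooth U (fun u => scal (x u) (y u)).
Proof. by move=> Sx Sy; apply: smooth_sum => // a; exact: smoothM. Qed.

Lemma partial_scal k x y u : vsmooth x -> vsmooth y -> U u ->
  partial k (fun v => scal (x v) (y v)) u =
  scal (partial k x u) (y u) + scal (x u) (partial k y u).
Proof.
move=> Sx Sy Uu; rewrite /scal (partial_sum oU)//; last by move=> a; exact: smoothM.
rewrite -big_split/=; apply: eq_bigr => a _.
by rewrite (partialM _ (Sx a) (Sy a) Uu) !partial_coord.
Qed.

Lemma partialZ k f x u : smooth U f -> vsmooth x -> U u ->
  partial k (fun v => f v *: x v) u = partial k f u *: x u + f u *: partial k x u.
Proof.
move=> Sf Sx Uu; apply/rowP => a; rewrite partial_coord//; last exact: vsmoothZ.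
rewrite !mxE partial_coord// -(partialM _ Sf (Sx a) Uu);
by apply: (partial_ext oU) => // v _; rewrite mxE.
Qed.

Lemma vpartialD k x y u : vsmooth x -> vsmooth y -> U u ->
  partial k (fun v => x v + y v) u = partial k x u + partial k y u.
Proof.
move=> Sx Sy Uu; apply/rowP => a; rewrite partial_coord//; last exact: vsmoothD.
rewrite !mxE !partial_coord// -(partialD _ (Sx a) (Sy a) Uu);
by apply: (partial_ext oU) => // v _; rewrite mxE.
Qed.

Lemma vpartial_sum k n (x : 'I_n -> 'rV[R]_2 -> 'rV[R]_3) u :
  (forall m, vsmooth (x m)) -> U u ->
  partial k (fun v => \sum_m x m v) u = \sum_m partial k (x m) u.
Proof.
move=> Sx Uu; apply/rowP => a; rewrite partial_coord//; last exact: vsmooth_sum.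
rewrite summxE; under eq_bigr do rewrite partial_coord//.
rewrite -(partial_sum oU)//; last by move=> m; exact: Sx.
by apply: (partial_ext oU) => // v _; rewrite summxE.
Qed.

Lemma vschwarz i j x u : vsmooth x -> U u -> partial i (partial j x) u = partial j (partial i x) u.
Proof.
move=> Sx Uu; apply/rowP => a.
have E k l : partial k (partial l x) u 0 a = partial k (partial l (fun v => x v 0 a)) u.
  apply: etrans (partial_coord k a (vsmooth_partial l Sx) Uu) _.
  apply: (partial_ext oU) => // v; rewrite inE => Uv; exact: partial_coord.
exact: (etrans (E i j) (etrans (schwarz oU i j (Sx a) Uu) (esym (E j i)))).
Qed.

End VectorFields.

(** * Scalar product of the 3-space *)

Section ScalarProduct.
Context {R : realType}.
Implicit Types (x y z v : 'rV[R]_3).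

Lemma scalC x y : scal x y = scal y x.
Proof. by apply: eq_bigr => a _; rewrite mulrC. Qed.

Lemma scalDl x y z : scal (x + y) z = scal x z + scal y z.
Proof.
by rewrite -big_split/=; apply: eq_bigr => a _; rewrite mxE mulrDl.
Qed.

Lemma scalZl (c : R) x z : scal (c *: x) z = c * scal x z.
Proof. by rewrite /scal mulr_sumr; apply: eq_bigr => a _; rewrite mxE mulrA. Qed.

Lemma scalNl x z : scal (- x) z = - scal x z.
Proof. by rewrite -scaleN1r scalZl mulN1r. Qed.

Lemma scal_suml n (x : 'I_n -> 'rV[R]_3) z :
  scal (\sum_m x m) z = \sum_m scal (x m) z.
Proof.
rewrite /scal exchange_big/=; apply: eq_bigr => a _.
by rewrite summxE mulr_suml.
Qed.

Lemma scal3 x y : scal x y = x 0 0 * y 0 0 + x 0 1 * y 0 1 + x 0 2%R * y 0 2%R.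
Proof.
rewrite /scal !big_ord_recl big_ord0 addr0 addrA.
by congr (_ + _ * _ + _ * _); congr (_ 0 _); apply/val_inj.
Qed.

Lemma ord3P (a : 'I_3) : [\/ a = 0, a = 1 | a = 2%R].
Proof.
by case: a => [[|[|[|//]]]] ?; [constructor 1|constructor 2|constructor 3];
  apply/val_inj.
Qed.

(* Cramer's rule in the basis (x, y, z), whose squared volume is the Gram
   determinant. *)
Lemma scal_basis_eq0 x y z v :
  scal x x * scal y y - scal x y ^+ 2 != 0 -> scal z z = 1 ->
  scal z x = 0 -> scal z y = 0 ->
  scal v x = 0 -> scal v y = 0 -> scal v z = 0 -> v = 0.
Proof.
rewrite !scal3.
set x0 := x 0 0; set x1 := x 0 1; set x2 := x 0 2%R.
set y0 := y 0 0; set y1 := y 0 1; set y2 := y 0 2%R.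
set z0 := z 0 0; set z1 := z 0 1; set z2 := z 0 2%R.
move=> G zz zx zy vx vy vz.
pose c0 := x1 * y2 - x2 * y1; pose c1 := x2 * y0 - x0 * y2; pose c2 := x0 * y1 - x1 * y0.
pose D := c0 * z0 + c1 * z1 + c2 * z2.
have D0 : D != 0.
  apply: contraNneq G => D0.
  (* [D ^+ 2] is the Gram determinant of [x], [y], [z]; it differs from that of [x], [y] by
     multiples of [1 - <z,z>], [<z,x>] and [<z,y>], all of them zero here. *)
  have -> : (x0 * x0 + x1 * x1 + x2 * x2) * (y0 * y0 + y1 * y1 + y2 * y2) -
     (x0 * y0 + x1 * y1 + x2 * y2) ^+ 2 = D ^+ 2
     + (1 - (z0 * z0 + z1 * z1 + z2 * z2)) * (c0 ^+ 2 + c1 ^+ 2 + c2 ^+ 2)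
     + (z0 * x0 + z1 * x1 + z2 * x2) *
       ((z0 * x0 + z1 * x1 + z2 * x2) * (y0 * y0 + y1 * y1 + y2 * y2) -
       (z0 * y0 + z1 * y1 + z2 * y2) * (x0 * y0 + x1 * y1 + x2 * y2))
     + (z0 * y0 + z1 * y1 + z2 * y2) *
       ((z0 * y0 + z1 * y1 + z2 * y2) * (x0 * x0 + x1 * x1 + x2 * x2) -
       (z0 * x0 + z1 * x1 + z2 * x2) * (x0 * y0 + x1 * y1 + x2 * y2)).
    by rewrite /D /c0 /c1 /c2; ring.
  by rewrite zz zx zy D0 subrr expr0n/=; apply/eqP; ring.
have E0 : D * v 0 0 = (v 0 0 * x0 + v 0 1 * x1 + v 0 2%R * x2) * (y1 * z2 - y2 * z1)
    + (v 0 0 * y0 + v 0 1 * y1 + v 0 2%R * y2) * (z1 * x2 - z2 * x1)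
    + (v 0 0 * z0 + v 0 1 * z1 + v 0 2%R * z2) * c0.
  by rewrite /D /c0 /c1 /c2; ring.
have E1 : D * v 0 1 = (v 0 0 * x0 + v 0 1 * x1 + v 0 2%R * x2) * (y2 * z0 - y0 * z2)
    + (v 0 0 * y0 + v 0 1 * y1 + v 0 2%R * y2) * (z2 * x0 - z0 * x2)
    + (v 0 0 * z0 + v 0 1 * z1 + v 0 2%R * z2) * c1.
  by rewrite /D /c0 /c1 /c2; ring.
have E2 : D * v 0 2%R = (v 0 0 * x0 + v 0 1 * x1 + v 0 2%R * x2) * (y0 * z1 - y1 * z0)
    + (v 0 0 * y0 + v 0 1 * y1 + v 0 2%R * y2) * (z0 * x1 - z1 * x0)
    + (v 0 0 * z0 + v 0 1 * z1 + v 0 2%R * z2) * c2.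
  by rewrite /D /c0 /c1 /c2; ring.
rewrite vx vy vz !mul0r !addr0 in E0 E1 E2.
apply/rowP => a; rewrite mxE; apply: (mulfI D0); rewrite mulr0.
by case: (ord3P a) => ->.
Qed.

End ScalarProduct.

(** * Simons' identity *)

Lemma sum2 (V : nmodType) (F : 'I_2 -> V) : \sum_(i < 2) F i = F 0 + F 1.
Proof.
by rewrite !big_ord_recl big_ord0 addr0; congr (F _ + F _); apply/val_inj.
Qed.

Lemma ord2P (i : 'I_2) : i = 0 \/ i = 1.
Proof. by case: i => [[|[|//]]] ?; [left|right]; apply/val_inj. Qed.

(** Lets [ring] prove a goal modulo hypotheses: these are first combined into one equation [p = q]
    with the right coefficients. *)
Lemma eq_sub (V : zmodType) (p q x y : V) : p = q -> x - y = p - q -> x = y.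
Proof. by move=> -> /eqP; rewrite subrr subr_eq0 => /eqP. Qed.

Section Simons.
Context {R : realType} (U : set 'rV[R]_2) (oU : open U).
Variables (Gam : 'I_2 -> 'I_2 -> 'I_2 -> 'rV[R]_2 -> R).
Variables (h b : 'I_2 -> 'I_2 -> 'rV[R]_2 -> R).
Implicit Types (i j k l m s t : 'I_2) (u : 'rV[R]_2).

Hypothesis Gam_smooth : forall k i j, smooth U (Gam k i j).
Hypothesis b_smooth : forall i j, smooth U (b i j).
Hypothesis h_smooth : forall i j, smooth U (h i j).
Hypothesis Gam_sym : forall u, U u -> forall k i j, Gam k i j u = Gam k j i u.
Hypothesis b_sym : forall u, U u -> forall i j, b i j u = b j i u.
Hypothesis h_sym : forall u, U u -> forall i j, h i j u = h j i u.

Let nabla2 l i j u : R := partial l (b i j) u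
  - \sum_(m < 2) Gam m l i u * b m j u
  - \sum_(m < 2) Gam m l j u * b i m u.

Let nabla3 k l i j u : R := partial k (nabla2 l i j) u
  - \sum_(m < 2) Gam m k l u * nabla2 m i j u
  - \sum_(m < 2) Gam m k i u * nabla2 l m j u
  - \sum_(m < 2) Gam m k j u * nabla2 l i m u.

Hypothesis codazzi : forall u, U u -> forall k l i,
  partial k (b l i) u + \sum_(m < 2) Gam m l i u * b k m u =
  partial l (b k i) u + \sum_(m < 2) Gam m k i u * b l m u.

Let A s k u := \sum_(t < 2) h s t u * b t k u.

(** The Gauss equation $R^s{}_{ikl} = b_{li} A^s_k - b_{ki} A^s_l$, with the curvature written out
    and each side collecting one order of [k] and [l]. In this form it is the tangential part of the
    symmetry of third derivatives of the position vector. *)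
Hypothesis gauss : forall u, U u -> forall s k l i,
  partial k (Gam s l i) u + \sum_(m < 2) Gam s k m u * Gam m l i u
    - b l i u * A s k u =
  partial l (Gam s k i) u + \sum_(m < 2) Gam s l m u * Gam m k i u
    - b k i u * A s l u.

(** Metric compatibility of the connection, stated for the inverse metric [h]. *)
Hypothesis partial_h : forall u, U u -> forall m k l,
  partial m (h k l) u = - (\sum_(s < 2) Gam k m s u * h s l u)
    - \sum_(s < 2) Gam l m s u * h k s u.

Hypothesis trace0 : forall u, U u ->
  \sum_(k < 2) \sum_(l < 2) h k l u * b k l u = 0.

Lemma nabla2_codazzi u : U u -> forall l i j,
  nabla2 l i j u = nabla2 i l j u.
Proof.
move=> Uu l i j; have := codazzi Uu l i j.
rewrite /nabla2 !sum2 => E.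
by rewrite !(Gam_sym Uu _ l i); apply: (eq_sub E); ring.
Qed.

Lemma nabla2_sym u : U u -> forall l i j, nabla2 l i j u = nabla2 l j i u.
Proof.
move=> Uu l i j; rewrite /nabla2 !sum2.
rewrite (partial_ext oU (g := b j i))//; last by move=> v; rewrite inE => Uv; exact: b_sym.
by rewrite !(b_sym Uu i) !(b_sym Uu _ j); ring.
Qed.

Lemma nabla3_codazzi u : U u -> forall k l i j,
  nabla3 k l i j u = nabla3 k i l j u.
Proof.
move=> Uu k l i j; rewrite /nabla3 !sum2.
rewrite (partial_ext oU (g := nabla2 i l j))//; last first.
  by move=> v; rewrite inE => Uv; exact: nabla2_codazzi.
rewrite !(nabla2_codazzi Uu i) !(nabla2_codazzi Uu l).
by rewrite (nabla2_codazzi Uu 0 l) (nabla2_codazzi Uu 1 l) ; ring.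
Qed.

Lemma nabla3_sym u : U u -> forall k l i j,
  nabla3 k l i j u = nabla3 k l j i u.
Proof.
move=> Uu k l i j; rewrite /nabla3 !sum2.
rewrite (partial_ext oU (g := nabla2 l j i))//; last first.
  by move=> v; rewrite inE => Uv; exact: nabla2_sym.
by rewrite !(nabla2_sym Uu _ _ j) !(nabla2_sym Uu _ i); ring.
Qed.

Lemma nabla2_smooth l i j : smooth U (nabla2 l i j).
Proof.
by do 2![apply: smoothB => //; last by
  apply: smooth_sum => // m; exact: smoothM]; exact: smooth_partial.
Qed.

Lemma partial_nabla2 u : U u -> forall k l i j,
  partial k (nabla2 l i j) u = partial k (partial l (b i j)) u
  - \sum_(m < 2) (partial k (Gam m l i) u * b m j u + Gam m l i u * partial k (b m j) u)
  - \sum_(m < 2) (partial k (Gam m l j) u * b i m u + Gam m l j u * partial k (b i m) u).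
Proof.
move=> Uu k l i j.
have SM s1 s2 s3 s4 s5 : smooth U (fun v => Gam s1 s2 s3 v * b s4 s5 v) by exact: smoothM.
have Sb : smooth U (partial l (b i j)) by exact: smooth_partial.
rewrite /nabla2 (partialB oU)//; first last.
- by apply: smooth_sum.
- by apply: smoothB => //; apply: smooth_sum.
rewrite (partialB oU)//; last by apply: smooth_sum.
rewrite !(partial_sum oU)//; congr (_ - _ - _); apply: eq_bigr => m _;
  exact: (partialM _ (Gam_smooth _ _ _) (b_smooth _ _) Uu).
Qed.

(** Contraction with [h] commutes with the covariant derivative, [h] being parallel by [partial_h];
    hence the trace of [nabla2] is the derivative of a vanishing trace. *)
Lemma nabla2_trace u : U u -> forall m,
  \sum_(k < 2) \sum_(l < 2) h k l u * nabla2 m k l u = 0.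
Proof.
move=> Uu m.
have : partial m (fun v => \sum_(k < 2) \sum_(l < 2) h k l v * b k l v) u = 0.
  rewrite (partial_ext oU (g := fun=> 0))//; first exact: partial_cst.
  by move=> v; rewrite inE => Uv; exact: trace0.
have SM k l : smooth U (fun v => h k l v * b k l v) by exact: smoothM.
rewrite (partial_sum oU)//; last by move=> k; exact: smooth_sum.
rewrite !sum2 !(partial_sum oU)// !sum2.
rewrite !(partialM _ (h_smooth _ _) (b_smooth _ _) Uu) !partial_h// /nabla2 !sum2.
by move=> <-; ring.
Qed.

Lemma nabla3_trace u : U u -> forall i m,
  \sum_(k < 2) \sum_(l < 2) h k l u * nabla3 i m k l u = 0.
Proof.
move=> Uu i m.
have : partial i (fun v => \sum_(k < 2) \sum_(l < 2) h k l v * nabla2 m k l v) u = 0.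
  rewrite (partial_ext oU (g := fun=> 0))//; first exact: partial_cst.
  by move=> v; rewrite inE => Uv; exact: nabla2_trace.
have SM k l : smooth U (fun v => h k l v * nabla2 m k l v).
  by apply: smoothM => //; exact: nabla2_smooth.
rewrite (partial_sum oU)//; last by move=> k; exact: smooth_sum.
rewrite !sum2 !(partial_sum oU)// !sum2.
rewrite !(partialM _ (h_smooth _ _) (nabla2_smooth _ _ _) Uu) !partial_h//.
have := nabla2_trace Uu 0; have := nabla2_trace Uu 1.
rewrite /nabla3 !sum2.
move: (partial i (nabla2 m 0 0) u) (partial i (nabla2 m 0 1) u)
  (partial i (nabla2 m 1 0) u) (partial i (nabla2 m 1 1) u) => p00 p01 p10 p11.
move=> T1 T0 E.
(* Differentiating the trace leaves the correction for the free index [m]: Christoffel symbols times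
   traces of [nabla2], which vanish by [T0] and [T1]. *)
have /= C := f_equal2 (fun x y => x - y) E
  (f_equal2 (fun x y => Gam 0 i m u * x + Gam 1 i m u * y) T0 T1).
by apply: (eq_sub C); ring.
Qed.

(** In the commutator the second partials of [b] cancel by Schwarz and the terms in [Gam m k l] by
    symmetry. What remains is the curvature acting on both indices of [b], expressed through
    [gauss]. *)
Lemma ricci u : U u -> forall k l i j,
  nabla3 k l i j u - nabla3 l k i j u =
  - (\sum_(s < 2) (b l i u * A s k u - b k i u * A s l u) * b s j u)
  - \sum_(s < 2) (b l j u * A s k u - b k j u * A s l u) * b i s u.
Proof.
move=> Uu k l i j.
have G s a : b l a u * A s k u - b k a u * A s l u =
    partial k (Gam s l a) u + \sum_(m < 2) Gam s k m u * Gam m l a u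
    - partial l (Gam s k a) u - \sum_(m < 2) Gam s l m u * Gam m k a u.
  have := gauss Uu s k l a.
  set X := b l a u * _; set Y := b k a u * _ => E.
  transitivity (X - Y +
   ((partial k (Gam s l a) u + \sum_(m < 2) Gam s k m u * Gam m l a u - X) -
   (partial l (Gam s k a) u + \sum_(m < 2) Gam s l m u * Gam m k a u - Y))).
    by rewrite E; ring.
  by ring.
under eq_bigr do rewrite G.
under [X in _ = _ - X]eq_bigr do rewrite G.
rewrite /nabla3.
have -> : \sum_(m < 2) Gam m l k u * nabla2 m i j u =
    \sum_(m < 2) Gam m k l u * nabla2 m i j u.
  by apply: eq_bigr => m _; rewrite (Gam_sym Uu).
rewrite !partial_nabla2// (schwarz oU k l)//.
set X := \sum_(m < 2) Gam m k l u * nabla2 m i j u; clearbody X.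
rewrite /nabla2 !sum2.
by ring.
Qed.

(** In [E], Codazzi exchanges [l] and [i], Ricci commutes the derivatives [k] and [i], and Codazzi
    with symmetry leads to [nabla3 i j k l], whose trace over [k] and [l] vanishes. Among the
    contracted curvature terms, two that are cubic in [b] cancel each other. *)
Lemma simons u : U u -> forall i j,
  \sum_(k < 2) \sum_(l < 2) h k l u * nabla3 k l i j u =
  - (\sum_(k < 2) \sum_(l < 2) A k l u * A l k u) * b i j u.
Proof.
move=> Uu i j.
have E k l : nabla3 k l i j u = nabla3 i j k l u +
  (- (\sum_(s < 2) (b i l u * A s k u - b k l u * A s i u) * b s j u)
  - \sum_(s < 2) (b i j u * A s k u - b k j u * A s i u) * b l s u).
  rewrite nabla3_codazzi// -ricci// addrC nabla3_codazzi//.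
  rewrite [nabla3 i k l j u]nabla3_codazzi// [nabla3 i l k j u]nabla3_sym//.
  by rewrite [nabla3 i l j k u]nabla3_codazzi// [nabla3 i j l k u]nabla3_sym// subrK.
under eq_bigr do under eq_bigr do rewrite E mulrDr.
under eq_bigr do rewrite big_split/=.
rewrite big_split/= nabla3_trace// add0r.
(* The curvature term that has the trace of [b] as a factor. *)
have /= C := congr1 (fun x => x * \sum_(s < 2) A s i u * b s j u) (trace0 Uu).
apply: (eq_sub C); rewrite /A !sum2.
have h10 := h_sym Uu 1 0; have b10 := b_sym Uu 1 0.
by case: (ord2P i) => ->; case: (ord2P j) => ->; rewrite ?h10 ?b10; ring.
Qed.
End Simons.

(** * Gauss and Weingarten equations in a chart *)

Lemma invmx2 (R : fieldType) (A : 'M[R]_2) :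
  A 0 0 * A 1 1 - A 0 1 * A 1 0 != 0 ->
  A \in unitmx /\ forall i j, invmx A i j =
    (A 0 0 * A 1 1 - A 0 1 * A 1 0)^-1 *
      (if i == 0 then if j == 0 then A 1 1 else - A 0 1
       else if j == 0 then - A 1 0 else A 0 0).
Proof.
set d := (X in X != 0) => d0.
pose B := \matrix_(i < 2, j < 2) (if i == 0 then if j == 0 then A 1 1 else - A 0 1
       else if j == 0 then - A 1 0 else A 0 0).
have AB : A *m (d^-1 *: B) = 1%:M.
  apply/matrixP => i j; rewrite !mxE sum2 !mxE/=.
  by case: (ord2P i) => ->; case: (ord2P j) => -> /=; rewrite /d; field.
have [uA _] := mulmx1_unit AB; split=> // i j.
have -> : invmx A = d^-1 *: B.
  by rewrite -[LHS]mulmx1 -AB mulmxA mulVmx// mul1mx.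
by rewrite !mxE.
Qed.

(** Here [E], [F], [G] are the metric coefficients and [x], [y], [z] those of [b]. Eliminating [z]
    between the trace and the determinant leaves a sum of two nonnegative terms equal to zero. *)
Lemma trace_det_eq0 (R : realFieldType) (E F G x y z : R) :
  0 <= E -> 0 < E * G - F ^+ 2 ->
  G * x - 2 * F * y + E * z = 0 -> x * z - y ^+ 2 = 0 ->
  [/\ x = 0, y = 0 & z = 0].
Proof.
move=> E0 D0 T0 d0.
have En0 : E != 0.
  apply: contraTneq D0 => ->; rewrite mul0r sub0r oppr_gt0 -leNgt; exact: sqr_ge0.
have S : (E * y - F * x) ^+ 2 + (E * G - F ^+ 2) * x ^+ 2 = 0.
  have /= C := f_equal2 (fun a b => E * x * a - E ^+ 2 * b) T0 d0.
  by apply: (eq_sub C); ring.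
have x0 : x = 0.
  have : (E * G - F ^+ 2) * x ^+ 2 <= 0 by have := sqr_ge0 (E * y - F * x); lra.
  rewrite pmulr_rle0// => x2; apply/eqP; rewrite -sqrf_eq0 eq_le x2; exact: sqr_ge0.
rewrite x0 mulr0 mul0r !sub0r in T0 d0 *.
have y0 : y = 0 by move/eqP: d0; rewrite oppr_eq0 sqrf_eq0 => /eqP.
split=> //; apply: (mulfI En0); rewrite mulr0 -T0 y0; ring.
Qed.

Section Chart.
Context {R : realType} (U : set 'rV[R]_2) (oU : open U).
Variables (r n : 'rV[R]_2 -> 'rV[R]_3).
Implicit Types (i j k l m s t : 'I_2) (u : 'rV[R]_2).
Hypothesis Sr : vsmooth U r.
Hypothesis Sn : vsmooth U n.
Hypothesis nn : forall u, U u -> scal (n u) (n u) = 1.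
Hypothesis nr : forall u, U u -> forall i, scal (n u) (partial i r u) = 0.
Hypothesis gram_gt0 : forall u, U u ->
  0 < scal (partial 0 r u) (partial 0 r u) * scal (partial 1 r u) (partial 1 r u)
    - scal (partial 0 r u) (partial 1 r u) ^+ 2.

Let g i j u := scal (partial i r u) (partial j r u).
Let gm u : 'M[R]_2 := \matrix_(i, j) g i j u.
Let h k l u := invmx (gm u) k l.
Let b i j u := scal (partial i (partial j r) u) (n u).
(** Spelled as [christoffel] with [partial] for [pd], so that the unfolded [laplacian_second_form]
    is convertible to the left side of [simons]. *)
Let Gam k i j u := 2^-1 * \sum_(l < 2) h k l u *
  (partial i (fun v => gm v j l) u + partial j (fun v => gm v i l) u
   - partial l (fun v => gm v i j) u).
Let A s k u := \sum_(t < 2) h s t u * b t k u.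

Let gram_neq0 u : U u ->
  scal (partial 0 r u) (partial 0 r u) * scal (partial 1 r u) (partial 1 r u)
    - scal (partial 0 r u) (partial 1 r u) ^+ 2 != 0.
Proof. by move=> Uu; rewrite gt_eqF ?gram_gt0. Qed.

Let Sdr i : vsmooth U (partial i r). Proof. exact: vsmooth_partial. Qed.
Let Sddr i j : vsmooth U (partial i (partial j r)). Proof. exact: vsmooth_partial. Qed.
Let Sg i j : smooth U (g i j). Proof. exact: smooth_scal. Qed.
Let Sb i j : smooth U (b i j). Proof. exact: smooth_scal. Qed.

Let gE u i j : gm u i j = g i j u. Proof. by rewrite mxE. Qed.

Let g_sym u i j : g i j u = g j i u. Proof. exact: scalC. Qed.

Let det_neq0 u : U u -> gm u 0 0 * gm u 1 1 - gm u 0 1 * gm u 1 0 != 0.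
Proof.
by move=> Uu; have := gram_neq0 Uu; rewrite !gE (g_sym _ 1 0) expr2.
Qed.

Let hE u k l : U u -> h k l u = (g 0 0 u * g 1 1 u - g 0 1 u * g 0 1 u)^-1 *
   (if k == 0 then if l == 0 then g 1 1 u else - g 0 1 u
                    else if l == 0 then - g 0 1 u else g 0 0 u).
Proof.
move=> Uu; have [_ /(_ k l)] := invmx2 (det_neq0 Uu).
by rewrite (gE u 0 0) (gE u 1 1) (gE u 0 1) (gE u 1 0) (g_sym _ 1 0).
Qed.

Let h_sym u : U u -> forall k l, h k l u = h l k u.
Proof.
by move=> Uu k l; rewrite !hE//; case: (ord2P k) => ->; case: (ord2P l) => ->.
Qed.

Let Sh k l : smooth U (h k l).
Proof.
pose d u := g 0 0 u * g 1 1 u - g 0 1 u * g 0 1 u.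
have Sd : smooth U d by apply: smoothB => //; exact: smoothM.
have Sd' : smooth U (fun u => (d u)^-1).
  by apply: smoothV => // u; exact: gram_neq0.
apply: (smooth_ext oU (f := fun u => (d u)^-1 *
   (if k == 0 then if l == 0 then g 1 1 u else - g 0 1 u
                    else if l == 0 then - g 0 1 u else g 0 0 u))).
  by move=> u; rewrite inE => Uu; rewrite hE.
apply: smoothM => //.
by case: (k == 0); case: (l == 0) => //; exact: smoothN.
Qed.

Let hg u : U u -> forall k j, \sum_(m < 2) h k m u * g m j u = (k == j)%:R.
Proof.
move=> Uu k j; have [uA _] := invmx2 (det_neq0 Uu).
have /matrixP/(_ k j) := mulVmx uA; rewrite !mxE => <-.
by apply: eq_bigr => m _; rewrite gE.
Qed.

(** Nondegeneracy of the metric: an identity with an upper index may be checked after lowering it,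
    that is, by scalar products with the tangent vectors. *)
Let g_inj u : U u -> forall x y : 'I_2 -> R,
  (forall l, \sum_(m < 2) x m * g m l u = \sum_(m < 2) y m * g m l u) ->
  forall k, x k = y k.
Proof.
move=> Uu x y E k.
have H (z : 'I_2 -> R) : z k = \sum_(l < 2) h k l u * \sum_(m < 2) z m * g m l u.
  under eq_bigr do rewrite mulr_sumr.
  rewrite exchange_big/=.
  under eq_bigr => m _.
    under eq_bigr => l _ do rewrite mulrCA (g_sym _ m).
    rewrite -mulr_sumr hg//.
  over.
  by rewrite !sum2; case: (ord2P k) => -> /=; rewrite mulr1 mulr0 ?addr0 ?add0r.
by rewrite (H x) (H y); apply: eq_bigr => l _; rewrite E.
Qed.

Let ddr_sym u : U u -> forall i j, partial i (partial j r) u = partial j (partial i r) u.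
Proof. by move=> Uu i j; exact: vschwarz Uu. Qed.

Let b_sym u : U u -> forall i j, b i j u = b j i u.
Proof. by move=> Uu i j; rewrite /b ddr_sym. Qed.

Let partial_g u : U u -> forall k i j,
  partial k (g i j) u =
    scal (partial k (partial i r) u) (partial j r u) + scal (partial k (partial j r) u) (partial i r u).
Proof.
move=> Uu k i j; rewrite [X in _ + X]scalC.
exact: (partial_scal oU k (Sdr i) (Sdr j) Uu).
Qed.

(** The three derivatives of the metric give six scalar products; four cancel in pairs and the other
    two coincide, which absorbs the factor 1/2. *)
Let GamE u : U u -> forall k i j, Gam k i j u =
  \sum_(l < 2) h k l u * scal (partial i (partial j r) u) (partial l r u).
Proof.
move=> Uu k i j; rewrite /Gam mulr_sumr; apply: eq_bigr => l _.
have E p q : (fun v => gm v p q) = g p q by apply/funext => v; rewrite gE.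
rewrite !E !partial_g// -/(h k l u).
rewrite (ddr_sym Uu j i) (ddr_sym Uu l j) (ddr_sym Uu l i).
by field.
Qed.

Let Gam_sym u : U u -> forall k i j, Gam k i j u = Gam k j i u.
Proof. by move=> Uu k i j; rewrite !GamE// (ddr_sym Uu i j). Qed.

Let SGam k i j : smooth U (Gam k i j).
Proof.
apply: (smooth_ext oU (f := fun u =>
    \sum_(l < 2) h k l u * scal (partial i (partial j r) u) (partial l r u))).
  by move=> u; rewrite inE => Uu; rewrite GamE.
by apply: smooth_sum => // l; apply: smoothM => //; exact: smooth_scal.
Qed.

Let Gam_g u : U u -> forall i j l,
  \sum_(m < 2) Gam m i j u * g m l u = scal (partial i (partial j r) u) (partial l r u).
Proof.
move=> Uu i j l.
under eq_bigr => m _ do rewrite GamE// mulr_suml.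
rewrite exchange_big/=.
under eq_bigr => t _.
  under eq_bigr => m _ do rewrite (h_sym Uu m t) mulrAC.
  rewrite -mulr_suml hg//.
over.
by rewrite !sum2; case: (ord2P l) => -> /=; rewrite mul1r mul0r ?addr0 ?add0r.
Qed.

Let frame_eq0 u (v : 'rV[R]_3) : U u -> (forall l, scal v (partial l r u) = 0) ->
  scal v (n u) = 0 -> v = 0.
Proof.
move=> Uu vr vn.
exact: (scal_basis_eq0 (gram_neq0 Uu) (nn Uu) (nr Uu 0) (nr Uu 1) (vr 0) (vr 1) vn).
Qed.

Let gauss_formula u : U u -> forall i j, partial i (partial j r) u =
  \sum_(m < 2) Gam m i j u *: partial m r u + b i j u *: n u.
Proof.
move=> Uu i j; apply/eqP; rewrite -subr_eq0; apply/eqP; apply: (frame_eq0 Uu) => [l|].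
  rewrite scalDl scalNl scalDl scal_suml scalZl nr// mulr0 addr0.
  under eq_bigr do rewrite scalZl.
  by rewrite -(Gam_g Uu) subrr.
rewrite scalDl scalNl scalDl scal_suml scalZl nn// mulr1.
rewrite big1 ?add0r ?subrr// => m _.
by rewrite scalZl scalC nr// mulr0.
Qed.

Let dn_n u : U u -> forall k, scal (partial k n u) (n u) = 0.
Proof.
move=> Uu k.
have : partial k (fun v => scal (n v) (n v)) u = 0.
  rewrite (partial_ext oU (g := fun=> (1 : R)))//; first exact: partial_cst.
  by move=> v; rewrite inE => Uv; exact: nn.
rewrite (partial_scal oU k Sn Sn Uu) (scalC (n u)) -mulr2n => /eqP.
by rewrite mulrn_eq0/= => /eqP.
Qed.

Let dn_r u : U u -> forall k l, scal (partial k n u) (partial l r u) = - b k l u.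
Proof.
move=> Uu k l.
have : partial k (fun v => scal (n v) (partial l r v)) u = 0.
  rewrite (partial_ext oU (g := fun=> (0 : R)))//; first exact: partial_cst.
  by move=> v; rewrite inE => Uv; exact: nr.
by rewrite (partial_scal oU k Sn (Sdr l) Uu) [X in _ + X]scalC => /eqP; rewrite addr_eq0 => /eqP.
Qed.

(** The differentiated Gauss formula. Its left side is symmetric in [k] and [l]; normal components
    then give Codazzi, tangential ones the Gauss equation. *)
Let dddr u : U u -> forall k l i, partial k (partial l (partial i r)) u =
  \sum_(m < 2) (partial k (Gam m l i) u *: partial m r u
    + Gam m l i u *: partial k (partial m r) u)
  + (partial k (b l i) u *: n u + b l i u *: partial k n u).
Proof.
move=> Uu k l i.
rewrite (partial_ext oU (g := fun v =>
  \sum_(m < 2) Gam m l i v *: partial m r v + b l i v *: n v))//; last first.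
  by move=> v; rewrite inE => Uv; exact: gauss_formula.
have SZ m : vsmooth U (fun v => Gam m l i v *: partial m r v) by exact: vsmoothZ.
rewrite (vpartialD oU k (vsmooth_sum oU SZ) (vsmoothZ oU (Sb l i) Sn) Uu).
rewrite (vpartial_sum oU k SZ Uu) (partialZ oU k (Sb l i) Sn Uu); congr (_ + _).
by apply: eq_bigr => m _; rewrite (partialZ oU k (SGam m l i) (Sdr m) Uu).
Qed.

Let dddr_sym u : U u -> forall k l i,
  partial k (partial l (partial i r)) u = partial l (partial k (partial i r)) u.
Proof. by move=> Uu k l i; exact: (vschwarz oU k l (Sdr i) Uu). Qed.

Let codazzi u : U u -> forall k l i,
  partial k (b l i) u + \sum_(m < 2) Gam m l i u * b k m u =
  partial l (b k i) u + \sum_(m < 2) Gam m k i u * b l m u.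
Proof.
move=> Uu.
have E k l i : scal (partial k (partial l (partial i r)) u) (n u) =
    partial k (b l i) u + \sum_(m < 2) Gam m l i u * b k m u.
  rewrite dddr// scalDl scal_suml scalDl !scalZl dn_n// nn// mulr0 addr0 mulr1 addrC.
  congr (_ + _); apply: eq_bigr => m _.
  by rewrite scalDl !scalZl (scalC (partial m r u)) nr// mulr0 add0r.
by move=> k l i; rewrite -!E dddr_sym.
Qed.

Let A_g u : U u -> forall k l, \sum_(m < 2) A m k u * g m l u = b l k u.
Proof.
move=> Uu k l; rewrite /A.
under eq_bigr => m _ do rewrite mulr_suml.
rewrite exchange_big/=.
under eq_bigr => t _.
  under eq_bigr => m _ do rewrite (h_sym Uu m t) mulrAC.
  rewrite -mulr_suml hg//.
over.
by rewrite !sum2; case: (ord2P l) => -> /=; rewrite mul1r mul0r ?addr0 ?add0r.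
Qed.

Let gauss u : U u -> forall s k l i,
  partial k (Gam s l i) u + \sum_(m < 2) Gam s k m u * Gam m l i u
    - b l i u * A s k u =
  partial l (Gam s k i) u + \sum_(m < 2) Gam s l m u * Gam m k i u
    - b k i u * A s l u.
Proof.
move=> Uu s k l i.
pose P k' l' s' := partial k' (Gam s' l' i) u
  + \sum_(m < 2) Gam s' k' m u * Gam m l' i u - b l' i u * A s' k' u.
have E k' l' t : \sum_(s' < 2) P k' l' s' * g s' t u =
    scal (partial k' (partial l' (partial i r)) u) (partial t r u).
  rewrite /P dddr// scalDl scal_suml scalDl !scalZl dn_r// nr// mulr0 add0r.
  under [in RHS]eq_bigr => m _ do rewrite scalDl !scalZl -(Gam_g Uu).
  rewrite (b_sym Uu k' t) -(A_g Uu k' t) !sum2 -/(g 0 t u) -/(g 1 t u).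
  by ring.
apply: (g_inj Uu (x := P k l) (y := P l k)) => t.
by rewrite !E dddr_sym.
Qed.

(** Obtained by differentiating [h g = 1], with the derivative of [g] expressed through [Gam]. *)
Let partial_h u : U u -> forall m k l,
  partial m (h k l) u = - (\sum_(s < 2) Gam k m s u * h s l u)
    - \sum_(s < 2) Gam l m s u * h k s u.
Proof.
move=> Uu p k.
apply: (g_inj Uu (x := fun l => partial p (h k l) u)
  (y := fun l => - (\sum_(s < 2) Gam k p s u * h s l u)
    - \sum_(s < 2) Gam l p s u * h k s u)) => j.
have E : partial p (fun v => \sum_(m < 2) h k m v * g m j v) u = 0.
  rewrite (partial_ext oU (g := fun=> (k == j)%:R : R))//; first exact: partial_cst.
  by move=> v; rewrite inE => Uv; exact: hg.
(* Both sides equal [Gam k p j u], since [h] inverts [g]. *)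
have D : \sum_(s < 2) Gam s p j u * (\sum_(m < 2) h k m u * g m s u) =
    \sum_(s < 2) Gam k p s u * (\sum_(l < 2) h s l u * g l j u).
  under eq_bigr do rewrite hg//.
  under [RHS]eq_bigr do rewrite hg//.
  by rewrite !sum2; case: (ord2P k) => ->; case: (ord2P j) => -> /=; ring.
have SM m : smooth U (fun v => h k m v * g m j v) by exact: smoothM.
have dg m : partial p (g m j) u = \sum_(s < 2) Gam s p m u * g s j u
    + \sum_(s < 2) Gam s p j u * g m s u.
  rewrite partial_g// -!Gam_g//; congr (_ + _).
  by apply: eq_bigr => s _; rewrite (g_sym u m s).
rewrite (partial_sum oU)// in E.
have E' : \sum_(m < 2) (partial p (h k m) u * g m j u + h k m u *
    (\sum_(s < 2) Gam s p m u * g s j u + \sum_(s < 2) Gam s p j u * g m s u)) = 0.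
  by rewrite -[RHS]E; apply: eq_bigr => m _; rewrite (partialM _ (Sh k m) (Sg m j) Uu) dg.
have /= C := f_equal2 (fun x y => x - y) E' D.
by apply: (eq_sub C); rewrite !sum2; ring.
Qed.

Lemma harmonic_minimal_sff_eq0 u : U u ->
  (forall v, U v -> mean_curvature r n v = 0) ->
  (forall i j, laplacian_second_form r n i j u = 0) ->
  forall i j, b i j u = 0.
Proof.
move=> Uu; rewrite /laplacian_second_form /cov3 /cov2 /christoffel.
rewrite /mean_curvature /metric_inv /metric /second_form pd_partial => H L.
have T v : U v -> \sum_(k < 2) \sum_(l < 2) h k l v * b k l v = 0.
  move=> Uv; have /eqP := H v Uv; rewrite mulf_eq0 invr_eq0 pnatr_eq0/=.
  by move=> /eqP.
have Q i j : (\sum_(k < 2) \sum_(l < 2) A k l u * A l k u) * b i j u = 0.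
  apply: oppr_inj; rewrite oppr0 -mulNr.
  rewrite -(simons oU SGam Sb Sh Gam_sym b_sym h_sym codazzi gauss partial_h T Uu).
  exact: L.
have D0 : g 0 0 u * g 1 1 u - g 0 1 u * g 0 1 u != 0 by rewrite -expr2; exact: gram_neq0.
have T' : g 1 1 u * b 0 0 u - 2 * g 0 1 u * b 0 1 u + g 0 0 u * b 1 1 u = 0.
  apply: (mulfI (invr_neq0 D0)); rewrite mulr0 -[RHS](T u Uu) !sum2 !hE//=.
  by rewrite (b_sym Uu 1 0); ring.
suff Z : \sum_(k < 2) \sum_(l < 2) A k l u * A l k u = 0 -> forall i j, b i j u = 0.
  move=> i j; have /eqP := Q i j; rewrite mulf_eq0 => /orP[/eqP/Z//|/eqP//].
move=> S; have d0 : b 0 0 u * b 1 1 u - b 0 1 u ^+ 2 = 0.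
  have n0 : 2 * (g 0 0 u * g 1 1 u - g 0 1 u * g 0 1 u)^-1 != 0 :> R.
    by rewrite mulf_neq0 ?invr_neq0// pnatr_eq0.
  apply: (mulfI n0); rewrite mulr0; move: S; rewrite /A !sum2 !hE//= (b_sym Uu 1 0).
  set D := g 0 0 u * g 1 1 u - g 0 1 u * g 0 1 u => S.
  (* This is $(\mathrm{tr} A)^2 - \mathrm{tr}(A^2) = 2 \det A = 2 \det b / D$; the left side of [T']
     is [D] times the trace of [A]. *)
  have /= C := f_equal2 (fun x y => (D^-1 * x) ^+ 2 - y) T' S.
  apply: (eq_sub C).
  by rewrite /D; field.
have g0 : 0 <= g 0 0 u by apply: sumr_ge0 => a _; rewrite -expr2 sqr_ge0.
have [x0 y0 z0] := trace_det_eq0 g0 (gram_gt0 Uu) T' d0.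
by move=> i j; case: (ord2P i) => ->; case: (ord2P j) => ->; rewrite // b_sym.
Qed.

Lemma harmonic_minimal_normal_cst u : U u ->
  (forall v, U v -> mean_curvature r n v = 0) ->
  (forall i j, laplacian_second_form r n i j u = 0) ->
  forall i, partial i n u = 0.
Proof.
move=> Uu H L i; apply: (frame_eq0 Uu); last exact: dn_n.
by move=> l; rewrite dn_r// harmonic_minimal_sff_eq0// oppr0.
Qed.

End Chart.

(** * From charts to the whole surface *)

Section Frame.
Context {R : realType}.
Implicit Types (x y v : 'rV[R]_3).

Lemma scal_ge0 v : 0 <= scal v v.
Proof. by apply: sumr_ge0 => a _; rewrite -expr2 sqr_ge0. Qed.

Lemma scal_eq0 v : scal v v = 0 -> v = 0.
Proof.
move=> /eqP; rewrite psumr_eq0 => [/allP v0|a _]; last by rewrite -expr2 sqr_ge0.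
apply/rowP => a; rewrite mxE; apply/eqP.
by have := v0 a; rewrite mem_index_enum /= -expr2 sqrf_eq0; exact.
Qed.

(** Addition in ['I_3] is modulo 3, so one cyclic formula covers the three components. *)
Definition cross x y : 'rV[R]_3 :=
  \row_a (x 0 (a + 1) * y 0 (a + 2%R) - x 0 (a + 2%R) * y 0 (a + 1)).

Let crossE x y : (cross x y 0 0 = x 0 1 * y 0 2%R - x 0 2%R * y 0 1) *
  (cross x y 0 1 = x 0 2%R * y 0 0 - x 0 0 * y 0 2%R) *
  (cross x y 0 2%R = x 0 0 * y 0 1 - x 0 1 * y 0 0).
Proof.
have E0 : (1 + 2%R : 'I_3) = 0 by apply/val_inj.
have E1 : (2%R + 2%R : 'I_3) = 1 by apply/val_inj.
have E2 : (2%R + 1 : 'I_3) = 0 by apply/val_inj.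
by rewrite !mxE !add0r E0 E1 E2.
Qed.

Lemma scal_cross x y : scal (cross x y) x = 0 /\ scal (cross x y) y = 0.
Proof. by rewrite !scal3 !crossE; split; ring. Qed.

Lemma scal_cross_cross x y :
  scal (cross x y) (cross x y) = scal x x * scal y y - scal x y ^+ 2.
Proof. by rewrite !scal3 !crossE; ring. Qed.

(** The Gram determinant is the squared length of the cross product. If it vanished, so would
    [<y,y> x - <x,y> y], whose squared length is [<y,y>] times it; independence of the columns then
    gives [y = 0], a contradiction. *)
Lemma gram_gt0_of_rank (J : 'M[R]_(3, 2)) x y : (forall a, J a 0 = x 0 a) ->
  (forall a, J a 1 = y 0 a) -> \rank J = 2%N ->
  0 < scal x x * scal y y - scal x y ^+ 2.
Proof.
move=> Jx Jy rJ; rewrite lt0r -scal_cross_cross scal_ge0 andbT scal_cross_cross.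
have inj (w0 w1 : R) : w0 *: x + w1 *: y = 0 -> w0 = 0 /\ w1 = 0.
  move=> E; have fJ : row_free J^T by rewrite -row_leq_rank mxrank_tr rJ.
  have : (\row_i (if i == 0 then w0 else w1) : 'rV[R]_2) *m J^T = 0.
    apply/rowP => a; move/rowP/(_ a) : E; rewrite !mxE sum2 !mxE/= => <-.
    by rewrite Jx Jy.
  move/eqP; rewrite mulmx_free_eq0// => /eqP/rowP w.
  by have := w 0; have := w 1; rewrite !mxE/=.
apply/eqP => G0.
have [|yy0 _] := inj (scal y y) (- scal x y).
  apply: scal_eq0; rewrite scalDl !scalZl ![scal _ (_ + _)]scalC !scalDl !scalZl.
  rewrite (scalC y x) -[RHS](mulr0 (scal y y)) -G0; ring.
have [|_ /eqP] := inj 0 1; last by rewrite oner_eq0.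
by rewrite (scal_eq0 yy0) scaler0 scale0r addr0.
Qed.

End Frame.

Section Continuity.
Context {R : realType} (U : set 'rV[R]_2) (oU : open U).

Lemma vsmooth_continuous (x : 'rV[R]_2 -> 'rV[R]_3) (u : 'rV[R]_2) :
  vsmooth U x -> U u -> {for u, continuous x}.
Proof.
move=> Sx Uu A [P PA sPA].
have FF : Filter (nbhs u) := nbhs_filter u.
have N := @filter_forall _ 'I_3 (fun a v => P 0 a (x v 0 a)) (nbhs u) FF
  (fun a => smooth_continuous (Sx a) Uu (PA 0 a)).
apply: (@filterS _ (nbhs u) FF _ _ _ N) => v Pv.
by apply: sPA => i j; rewrite (ord1 i); exact: Pv.
Qed.

(** Balls of the matrix norm are squares, so [u] and [v] are joined inside by two segments parallel
    to the axes. *)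
Lemma ball_cst (f : 'rV[R]_2 -> R) u d : smooth U f -> ball u d `<=` U ->
  (forall v, ball u d v -> forall i, partial i f v = 0) ->
  forall v, ball u d v -> f v = f u.
Proof.
move=> Sf dU f0 v [d0 bv].
have ev : v = (v 0 0 - u 0 0) *: 'e_0 + ((v 0 1 - u 0 1) *: 'e_1 + u).
  apply/rowP => i; rewrite !mxE eqxx/=.
  by case: (ord2P i) => -> /=; ring.
have b0 : `|v 0 0 - u 0 0| < d by have := bv 0 0; rewrite /ball/= distrC.
have b1 : `|v 0 1 - u 0 1| < d by have := bv 0 1; rewrite /ball/= distrC.
have B (s t : R) : `|s| < d -> `|t| < d -> ball u d (s *: 'e_0 + (t *: 'e_1 + u)).
  move=> sd td; split=> // i j; rewrite (ord1 i) /ball/= !mxE eqxx/=.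
  case: (ord2P j) => -> /=.
    by rewrite [X in `|X|](_ : _ = - s) ?normrN//; ring.
  by rewrite [X in `|X|](_ : _ = - t) ?normrN//; ring.
have dd i w : ball u d w -> derivable f w 'e_i /\ 'D_('e_i) f w = 0.
  by move=> bw; rewrite -partialE f0//; split=> //; apply: (smooth_derivable Sf); exact: dU.
rewrite [in LHS]ev line_cst; last first.
  by move=> s sd; apply: dd; apply: B => //; exact: le_lt_trans sd b0.
apply: line_cst => s sd; apply: dd.
have := B 0 s; rewrite scale0r add0r; apply; first by rewrite normr0.
exact: le_lt_trans sd b1.
Qed.

End Continuity.

(** * Unit normal and plane of one local parametrization *)

Section LocalParam.
Context {R : realType} (M : topologicalType) (f : M -> 'rV[R]_3).
Variables (U : set 'rV[R]_2) (phi : 'rV[R]_2 -> M).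
Hypothesis Uphi : local_param f U phi.
Let r := f \o phi.

Let oU : open U. Proof. by case: Uphi. Qed.

Let Sr : vsmooth U r.
Proof. by case: Uphi => _ _ _ _ [Sr _]; exact: smooth_on_vsmooth. Qed.

Let gram u :=
  scal (partial 0 r u) (partial 0 r u) * scal (partial 1 r u) (partial 1 r u)
  - scal (partial 0 r u) (partial 1 r u) ^+ 2.

Let gram_gt0 u : U u -> 0 < gram u.
Proof.
case: Uphi => _ _ _ _ [_ rk] Uu.
by apply: gram_gt0_of_rank (rk u Uu) => a; rewrite mxE pd_partial.
Qed.

Definition normal u := (Num.sqrt (gram u))^-1 *: cross (partial 0 r u) (partial 1 r u).

Let Sn : vsmooth U normal.
Proof.
have Sdr i : vsmooth U (partial i r) by exact: vsmooth_partial.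
apply: vsmoothZ => //.
  apply: smooth_rsqrt => //.
  apply: smoothB => //; first by apply: smoothM => //; exact: smooth_scal.
  by apply: smoothM => //; exact: smooth_scal.
move=> a; apply: (smooth_ext oU (f := fun u =>
  partial 0 r u 0 (a + 1) * partial 1 r u 0 (a + 2%R)
  - partial 0 r u 0 (a + 2%R) * partial 1 r u 0 (a + 1))).
  by move=> u _; rewrite mxE.
by apply: smoothB => //; apply: smoothM => //; exact: Sdr.
Qed.

Let nn u : U u -> scal (normal u) (normal u) = 1.
Proof.
move=> Uu; have G0 := gram_gt0 Uu.
rewrite scalZl scalC scalZl scal_cross_cross -/(gram u) mulrA -expr2 exprVn.
by rewrite sqr_sqrtr ?ltW// mulVf ?gt_eqF.
Qed.

Let nr u i : scal (normal u) (partial i r u) = 0.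
Proof.
rewrite scalZl; have [c0 c1] := scal_cross (partial 0 r u) (partial 1 r u).
by case: (ord2P i) => ->; rewrite ?c0 ?c1 mulr0.
Qed.

Lemma normal_unit_normal_field : unit_normal_field r normal U.
Proof.
split.
  rewrite continuous_open_subspace// => u; rewrite inE => Uu.
  exact: (vsmooth_continuous Sn).
by move=> u Uu; split=> [|i]; rewrite ?pd_partial ?nn ?nr.
Qed.

Hypothesis minimal : forall u, U u -> mean_curvature r normal u = 0.
Hypothesis harmonic : forall u, U u ->
  forall i j, laplacian_second_form r normal i j u = 0.

(** The uniqueness clause serves the gluing of pieces. It supposes that [P'] contains the surface
    near [q], so that the equation of [P'] can be differentiated: its normal is then orthogonal to
    the tangent vectors at [q], hence a multiple of the constant unit normal. *)
Lemma local_plane p : (phi @` U) p ->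
  exists (W : set M) (P : set 'rV[R]_3), [/\ open W, W p, is_plane P,
    f @` W `<=` P & forall q P', W q -> is_plane P' ->
      (\forall x \near q, P' (f x)) -> P' = P].
Proof.
case=> u0 Uu0 <-.
have /nbhs_ballP[d /= d0 dU] := nbhs_U oU Uu0.
have bU : open (ball u0 d) by exact: ball_open.
have nc v : ball u0 d v -> normal v = normal u0.
  move=> bv; apply/rowP => a.
  apply: (ball_cst (Sn a) dU _ bv) => w bw i.
  rewrite -(partial_coord i a Sn (dU _ bw)).
  rewrite (harmonic_minimal_normal_cst oU Sr Sn nn (fun u _ i => nr u i)
    gram_gt0 (dU _ bw) minimal (harmonic (dU _ bw)) i).
  by rewrite mxE.
have Sc w : vsmooth U (fun=> w) by move=> a; exact: smooth_cst.
have dsc w v i : U v -> partial i (fun x => scal w (r x)) v = scal w (partial i r v).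
  move=> Uv; rewrite (partial_scal oU i (Sc w) Sr Uv) [X in X + _](_ : _ = 0) ?add0r//.
  have -> : partial i (fun=> w) v = 0 by rewrite partialE derive_cst.
  by rewrite -(scale0r 0) scalZl mul0r.
have pc v : ball u0 d v -> scal (normal u0) (r v) = scal (normal u0) (r u0).
  apply: (ball_cst (f := fun x => scal (normal u0) (r x))
    (smooth_scal oU (Sc _) Sr) dU) => w bw i.
  by rewrite (dsc _ _ _ (dU _ bw)) -(nc w bw) nr.
exists (phi @` ball u0 d), [set x | scal (normal u0) x = scal (normal u0) (r u0)].
have [_ cphi _ ophi _] := Uphi.
split.
- exact: ophi.
- by exists u0 => //; exact: ballxx.
- exists (normal u0), (scal (normal u0) (r u0)); split=> //.
  apply: contra_eq_neq (nn Uu0) => ->.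
  by rewrite -(scale0r 0) scalZl mul0r eq_sym oner_eq0.
- by move=> _ [_ [v bv <-] <-]; exact: pc.
move=> _ P' [v bv <-] [w [c [w0 ->]]] Pv.
have Uv := dU v bv.
have near_c : \forall x \near v, scal w (r x) = c.
  have cv : {for v, continuous phi}.
    by move: cphi; rewrite continuous_open_subspace//; apply; rewrite inE.
  exact: cv Pv.
have wr i : scal w (partial i r v) = 0.
  rewrite -dsc// partialE (near_eq_derive (g := fun=> c))//.
  by rewrite derive_cst.
have wE : w = scal w (normal v) *: normal v.
  apply/eqP; rewrite -subr_eq0; apply/eqP.
  apply: (scal_basis_eq0 (lt0r_neq0 (gram_gt0 Uv)) (nn Uv) (nr v 0) (nr v 1)).
  - by rewrite scalDl scalNl scalZl wr nr mulr0 subr0.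
  - by rewrite scalDl scalNl scalZl wr nr mulr0 subr0.
  - by rewrite scalDl scalNl scalZl nn// mulr1 subrr.
have t0 : scal w (normal v) != 0.
  by apply: contra_neq w0 => t0; rewrite wE t0 scale0r.
have cE := nbhs_singleton near_c.
have E x : scal w x = scal w (normal v) * scal (normal u0) x.
  by rewrite {1}wE scalZl (nc v bv).
have cE' : c = scal w (normal v) * scal (normal u0) (r u0).
  by rewrite -cE E (pc v bv).
apply/seteqP; split => x /=; rewrite E cE'; first by move/(mulfI t0).
by move=> ->.
Qed.

End LocalParam.

(** * Gluing by connectedness *)

Lemma connected_plane (R : realType) (M : topologicalType) (f : M -> 'rV[R]_3) :
  connected [set: M] ->
  (forall p, exists (W : set M) (P : set 'rV[R]_3), [/\ open W, W p, is_plane P,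
    f @` W `<=` P & forall q P', W q -> is_plane P' ->
      (\forall x \near q, P' (f x)) -> P' = P]) ->
  exists P : set 'rV[R]_3, is_plane P /\ f @` [set: M] `<=` P.
Proof.
move=> conn loc.
have [[p0 _]|M0] := EM ([set: M] !=set0); last first.
  (* The empty surface lies in any plane; this one is arbitrary. *)
  exists [set x | scal (const_mx 1) x = 0]; split.
    exists (const_mx 1), 0; split=> //; apply/eqP => /rowP/(_ 0)/eqP.
    by rewrite !mxE oner_eq0.
  by move=> y [p _ _]; case: M0; exists p.
have [W0 [P0 [oW0 Wp0 plane0 fW0 _]]] := loc p0.
have nearW W P q : open W -> W q -> f @` W `<=` P -> \forall x \near q, P (f x).
  move=> oW Wq fW; apply: filterS (open_nbhs_nbhs (conj oW Wq)) => x Wx.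
  by apply: fW; exists x.
(* Asking for a neighbourhood makes [A] open by construction. It is closed by the uniqueness clause,
   applied at a point [q'] where the piece [W] around a limit point meets [A]. *)
pose A := [set q : M | \forall x \near q, P0 (f x)].
have AT : A = [set: M].
  apply: conn.
  - by exists p0; exact: nearW fW0.
  - exists A; last by rewrite setTI.
    rewrite openE => q /nbhs_interior; exact.
  - exists A; last by rewrite setTI.
    move=> q clq; have [W [P [oW Wq planeP fW uniq]]] := loc q.
    have [q' [Aq' Wq']] := clq W (open_nbhs_nbhs (conj oW Wq)).
    have E := uniq q' P0 Wq' plane0 Aq'.
    by rewrite /A/= E; exact: nearW fW.
exists P0; split=> // _ [q _ <-].
have : A q by rewrite AT.
exact: nbhs_singleton.
Qed.

Theorem theorem0p1 (R : realType) (M : topologicalType) (f : M -> 'rV[R]_3)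
  (surf : is_surface f) (conn : connected [set: M])
  (minimal : is_minimal f) (harmonic : has_harmonic_second_form f) :
  exists P : set 'rV[R]_3, is_plane P /\ f @` [set: M] `<=` P.
Proof.
case: surf => _ _ charts; apply: connected_plane conn _ => p.
have [U [phi [Uphi Up]]] := charts p.
have N := normal_unit_normal_field Uphi.
exact: local_plane Uphi (minimal U phi _ Uphi N) (harmonic U phi _ Uphi N) p Up.
Qed.
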